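(* Let $T>0$, and let $H$ and $g$ be the Hamiltonian and terminal condition defined in the context. Let $U:[0,T]\times\mathbb{R}\to\mathbb{R}$ be given by $$U(t,x)=\begin{cases}\exp\!\big(-2\sqrt{x-t}\,\big)-1 & \text{if } x\ge t,\\ 1 & \text{if } x<t.\end{cases}$$ Then $U$ is a bounded lower semicontinuous solution of the Hamilton-Jacobi-Bellman equation with Hamiltonian $H$ and terminal condition $g$.
   Context: Define $\varphi:[0,T]\times\mathbb{R}\to\mathbb{R}$ by $\varphi(t,x)=\sqrt{|t-x|}\,\exp\!\big(2\sqrt{|t-x|}\big)$. The Hamiltonian $H:[0,T]\times\mathbb{R}\times\mathbb{R}\to\mathbb{R}$ is $$H(t,x,p)=\begin{cases}0 & \text{if } t\ne x,\ 2|p|\le \frac{1}{\varphi(t,x)},\\[1mm] 2|p|-\frac{1}{\varphi(t,x)} & \text{if } t\neq x,\ 2|p|>\frac{1}{\varphi(t,x)},\\[1mm] 0 & \text{if } t=x,\ p\in\mathbb{R}.\end{cases}$$ The terminal condition $g:\mathbb{R}\to\mathbb{R}$ is $g(x)=\exp(-2\sqrt{x-T})-1$ if $x\ge T$ and $g(x)=1$ if $x<T$. The Hamilton-Jacobi-Bellman (HJB) problem is $-U_t+H(t,x,-U_x)=0$ in $(0,T)\times\mathbb{R}$, $U(T,x)=g(x)$ on $\mathbb{R}$. Subgradients: for $f:\mathbb{R}^m\to\mathbb{R}\cup\{+\infty\}$ and $z$ with $f(z)<+\infty$, $\partial f(z)$ is the set of $v\in\mathbb{R}^m$ such that $\liminf_{y\to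 z}\frac{f(y)-f(z)-\langle v,y-z\rangle}{|y-z|}\ge 0$. A function defined on $[0,T]\times\mathbb{R}$ is extended by $+\infty$ outside $[0,T]\times\mathbb{R}$ when its subgradients are considered. Definition: a function $U:[0,T]\times\mathbb{R}\to\mathbb{R}\cup\{+\infty\}$ is a lower semicontinuous solution of HJB if (i) $U$ is lower semicontinuous and $U(T,x)=g(x)$ for all $x\in\mathbb{R}$; (ii) for every $(t,x)$ with $U(t,x)<+\infty$ and every $(p_t,p_x)\in\partial U(t,x)$: $-p_t+H(t,x,-p_x)\ge 0$ if $0\le t<T$, and $-p_t+H(t,x,-p_x)\le 0$ if $0<t\le T$. *)

(* Defs.v *)
From mathcomp Require Import all_boot all_order all_algebra.
From mathcomp Require Import all_classical all_reals all_analysis.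

Set Implicit Arguments.
Unset Strict Implicit.
Unset Printing Implicit Defensive.

Import Order.TTheory GRing.Theory Num.Theory.
Import numFieldNormedType.Exports.

Local Open Scope classical_set_scope.
Local Open Scope ring_scope.

(* The norm MathComp-Analysis puts on row vectors is the sup norm, so the
   Euclidean scalar product and norm on R^m are spelled out. *)
Definition dotprod (R : realType) (m : nat) (v w : 'rV[R]_m) : R :=
  \sum_(i < m) v 0 i * w 0 i.

Definition eucl_norm (R : realType) (m : nat) (w : 'rV[R]_m) : R :=
  Num.sqrt (dotprod w w).

(* The liminf is over punctured neighbourhoods z^', so the quotient is never
   evaluated at y = z. *)
Definition subgradients (R : realType) (m : nat) (f : 'rV[R]_m -> \bar R)
    (z : 'rV[R]_m) : set 'rV[R]_m :=
  [set v | (f z < +oo)%E /\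
    (0 <= limf_einf (fun y : 'rV[R]_m =>
       (f y - f z - (dotprod v (y - z))%:E) * ((eucl_norm (y - z))^-1)%:E)
     z^')%E].

Definition strip (R : realType) (T : R) : set (R * R) :=
  [set z | 0 <= z.1 <= T].

Definition pair_vec (R : realType) (a b : R) : 'rV[R]_2 :=
  \row_(i < 2) [:: a; b]`_i.

(* Functions on [0, T] x R are represented by total functions of (t, x), whose
   values for t outside [0, T] are ignored. *)
Definition extend (R : realType) (T : R) (U : R -> R -> \bar R)
    (z : 'rV[R]_2) : \bar R :=
  if 0 <= z 0 0 <= T then U (z 0 0) (z 0 1) else +oo%E.

(* [subspace (strip T)] carries the topology induced on the strip and is
   discrete elsewhere, so the second clause is lower semicontinuity relative
   to [0, T] x R. *)
Definition lsc_solution (R : realType) (T : R) (H : R -> R -> R -> R)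
    (g : R -> R) (U : R -> R -> \bar R) : Prop :=
  [/\ forall t x, 0 <= t <= T -> U t x != -oo%E,
      lower_semicontinuous (fun z : subspace (strip T) => U z.1 z.2),
      forall x, U T x = (g x)%:E &
      forall t x, 0 <= t <= T -> (U t x < +oo)%E ->
      forall p_t p_x,
        subgradients (extend T U) (pair_vec t x) (pair_vec p_t p_x) ->
        (0 <= t < T -> 0 <= - p_t + H t x (- p_x)) /\
        (0 < t <= T -> - p_t + H t x (- p_x) <= 0)].

Definition phi (R : realType) (t x : R) : R :=
  Num.sqrt `|t - x| * expR (2 * Num.sqrt `|t - x|).

Definition hamiltonian (R : realType) (t x p : R) : R :=
  if t == x then 0
  else if 2 * `|p| <= 1 / phi t x then 0
  else 2 * `|p| - 1 / phi t x.

Definition terminal_cost (R : realType) (T x : R) : R :=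
  if T <= x then expR (- 2 * Num.sqrt (x - T)) - 1 else 1.

(* Main.v *)
Require Import Defs.
From mathcomp Require Import all_boot all_order all_algebra.
From mathcomp Require Import all_classical all_reals all_analysis.
From mathcomp Require Import ring lra.

Import Order.TTheory GRing.Theory Num.Theory.
Import numFieldNormedType.Exports.

Local Open Scope classical_set_scope.
Local Open Scope ring_scope.

(** The value function is a travelling wave, U(t, x) = h(x - t), whose profile h
is exp(-2 sqrt s) - 1 for s >= 0 and 1 for s < 0. Boundedness and the terminal
condition can be read off this formula. The profile jumps up to 1 just to the
left of the front s = 0, where its value is 0, so it is lower semicontinuous
([profile_near_gt]), and U inherits this through the continuous map
(t, x) |-> x - t.

For the subgradient inequalities, the only fact used about a subgradient v of f
at z is that the growth of f along a ray bounds v from above: if f(z + e d) is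
at most f(z) + c e for small e > 0, then the product of v with d is at most c
([subgradient_slope_le]). There are two cases.

- Away from the front, h is differentiable, with derivative D say. The
  rays (0, 1) and (0, -1) give p_x = D; the ray (1, 0), which stays in the strip
  if t < T, gives p_t <= - D, and the ray (-1, 0), which does so if t > 0, gives
  p_t >= - D ([travelling_subgradient_smooth]). So both inequalities reduce to
  D + H(t, x, - D) = 0. For x > t, D = - exp(-2 sqrt s) / sqrt s with s = x - t,
  which is - 1 / phi(t, x), and H(t, x, 1 / phi) = 2 / phi - 1 / phi = 1 / phi.
  For x < t, D = 0 and H(t, x, 0) = 0.

- On the front x = t the right slope of h is - oo, as exp(-2 sqrt e) - 1 is of
  the order of - 2 sqrt e ([profile_right_slope]). The ray (0, 1) would bound
  p_x by every real number, so there is no subgradient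
  ([profile_no_subgradient_diag]). *)

(** * Subgradients and slopes along rays *)

Lemma dotprodZr {R : realType} {m : nat} (v w : 'rV[R]_m) (k : R) :
  dotprod v (k *: w) = k * dotprod v w.
Proof.
by rewrite /dotprod mulr_sumr; apply: eq_bigr => i _; rewrite mxE mulrCA.
Qed.

Lemma eucl_normZ {R : realType} {m : nat} (w : 'rV[R]_m) (k : R) :
  0 <= k -> eucl_norm (k *: w) = k * eucl_norm w.
Proof.
move=> k0; rewrite /eucl_norm.
have -> : dotprod (k *: w) (k *: w) = k ^+ 2 * dotprod w w.
  by rewrite /dotprod mulr_sumr; apply: eq_bigr => i _; rewrite !mxE; ring.
by rewrite sqrtrM ?sqr_ge0// sqrtr_sqr ger0_norm.
Qed.

Lemma eucl_norm_gt0 {R : realType} {m : nat} {w : 'rV[R]_m} :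
  w != 0 -> 0 < eucl_norm w.
Proof.
move=> w0; rewrite sqrtr_gt0 lt_def sumr_ge0 => [|i _]; last first.
  by rewrite -expr2 sqr_ge0.
rewrite andbT; apply: contra w0 => /eqP/psumr_eq0P w0.
apply/eqP/rowP => i; rewrite mxE; apply/eqP; rewrite -sqrf_eq0 expr2; apply/eqP.
by apply: w0 => // j _; rewrite -expr2 sqr_ge0.
Qed.

(** Restricted to the ray, the difference quotient in the definition of
a subgradient is at most (c - v . d) / |d|, while its lower limit is
nonnegative. *)
Lemma subgradient_slope_le {R : realType} {m : nat} {f : 'rV[R]_m -> \bar R}
    {z v d : 'rV[R]_m} {c r : R} :
  subgradients f z v -> d != 0 -> f z = r%:E ->
  (\forall e \near 0^'+, (f (z + e *: d)%R <= (r + c * e)%:E)%E) ->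
  dotprod v d <= c.
Proof.
move=> [_ sub] d0 fz fle; have dp := eucl_norm_gt0 d0.
apply/ler_addgt0Pr => eps eps0.
(* this level becomes the error [eps] once multiplied by the length of [d] *)
have : (((- (eps / eucl_norm d))%:E : \bar R) < 0)%E.
  by rewrite lte_fin oppr_lt0 divr_gt0.
move=> /lt_le_trans/(_ sub); rewrite limf_einfE.
move=> /ereal_sup_gt[_ [V zV <-] aV].
have toz : (z + e *: d) @[e --> 0^'+] --> z^'.
  move=> A; rewrite /dnbhs /within/= => zA.
  have cz : (z + e *: d) @[e --> (0 : R)^'+] --> z.
    apply: cvg_at_right_filter.
    rewrite -[X in _ --> X]addr0 -[X in _ + X](scale0r d).
    by apply: cvgD; [exact: cvg_cst|apply: cvgZr_tmp; exact: cvg_id].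
  have ne : \forall e \near (0 : R)^'+, z + e *: d != z.
    near=> e; rewrite -subr_eq0 (addrC z) addrK scaler_eq0 negb_or d0 andbT.
    by rewrite gt_eqF//; near: e; exact: nbhs_right_gt.
  by apply: filterS2 ne (cz _ zA) => e /= ne; apply.
have : \forall e \near (0:R)^'+, dotprod v d <= c + eps.
  near=> e.
  have e0 : 0 < e by near: e; exact: nbhs_right_gt.
  have Ve : V (z + e *: d) by near: e; exact: toz.
  have fe : (f (z + e *: d)%R <= (r + c * e)%:E)%E by near: e.
  have {aV} := lt_le_trans aV (ereal_inf_lbound (imageP _ Ve)).
  have ed0 : 0 < e * eucl_norm d by rewrite mulr_gt0.
  rewrite fz (addrAC z) (subrr z) add0r dotprodZr.
  rewrite (eucl_normZ _ _ (ltW e0)) => aV.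
  have quot_le : ((f (z + e *: d)%R - r%:E - (e * dotprod v d)%:E) *
     ((e * eucl_norm d)^-1)%:E <=
     ((r + c * e)%:E - r%:E - (e * dotprod v d)%:E) *
     ((e * eucl_norm d)^-1)%:E)%E.
    apply: lee_wpmul2r; first by rewrite lee_fin invr_ge0 ltW.
    by do 2 apply: leeB => //.
  have := lt_le_trans aV quot_le.
  rewrite -!EFinB -EFinM lte_fin ltr_pdivlMr// => slope_gt.
  have : e * dotprod v d < e * (c + eps).
    have E : - (eps / eucl_norm d) * (e * eucl_norm d) = - e * eps.
      by field; rewrite gt_eqF.
    by move: slope_gt; rewrite E; lra.
  by rewrite (ltr_pM2l e0) => /ltW.
by move=> /filter_ex[].
Unshelve. all: by end_near. Qed.

(** Supplies the growth bound along a ray at a point where the function is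
differentiable; [k] is the speed at which the ray crosses the level lines of the
argument, and may be negative. *)
Lemma right_slope_le {R : realType} {h : R -> R} {s k D c : R} :
  is_derive s 1 h D -> k * D < c ->
  \forall e \near 0^'+, h (s + k * e) <= h s + c * e.
Proof.
move=> [dh Dh] kDc; have dfh := (derivable1_diffP _ _).1 dh.
have dhk := @diff_derivable _ _ _ h s k dfh.
have Dk : 'D_k h s < c.
  rewrite deriveE// -[k]mulr1 -[k * 1]/(k *: 1) linearZ -deriveE//.
  by rewrite Dh.
have := cvgr_lt _ (cvg_dnbhs_at_right dhk) _ Dk; rewrite /= => hc.
near=> e.
have e0 : 0 < e by near: e; exact: nbhs_right_gt.
have : e^-1 * (h (e * k + s) - h s) < c by near: e; exact: hc.
rewrite mulrC ltr_pdivrMr// => /ltW.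
by rewrite lerBlDl (mulrC k) (addrC s).
Unshelve. all: by end_near. Qed.

(** * The wave profile *)

Definition profile {R : realType} (s : R) : R :=
  if 0 <= s then expR (- 2 * Num.sqrt s) - 1 else 1.

Lemma profileE {R : realType} (t x : R) :
  (if t <= x then expR (- 2 * Num.sqrt (x - t)) - 1 else 1) = profile (x - t).
Proof. by rewrite /profile subr_ge0. Qed.

Lemma is_derive_profile_pos {R : realType} {s : R} : 0 < s ->
  is_derive s 1 profile (- (expR (- 2 * Num.sqrt s) / Num.sqrt s)).
Proof.
move=> s0; have q0 : 0 < Num.sqrt s by rewrite sqrtr_gt0.
apply: (@near_eq_is_derive _ _ _ (fun y => expR (- 2 * Num.sqrt y) - 1)).
  near=> y; rewrite /profile ifT//; apply: ltW.
  by near: y; exact: lt_nbhsr.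
have := is_derive1_sqrt s0 => ds.
have dg : is_derive s 1 (-2 \*: (Num.sqrt : R -> R)) (- (Num.sqrt s)^-1).
  apply: (@is_derive_eq _ _ _ _ _ _ _ _ (is_deriveZ (- 2) ds)).
  by rewrite /GRing.scale /=; field; rewrite gt_eqF.
have de := is_derive_expR (- 2 * Num.sqrt s).
have := is_deriveB (is_derive1_comp (f := expR) (g := -2 \*: Num.sqrt) de dg)
  (is_derive_cst (1 : R) s 1).
by rewrite subr0 mulrN.
Unshelve. all: by end_near. Qed.

Lemma is_derive_profile_neg {R : realType} {s : R} : s < 0 ->
  is_derive s 1 profile 0.
Proof.
move=> s0.
apply: (@near_eq_is_derive _ _ _ (cst (1 : R))).
  near=> y; rewrite /profile leNgt ifF//; apply/negbTE/negPn; near: y.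
exact: lt_nbhsl.
Unshelve. all: by end_near. Qed.

(** The square root makes the right slope at the front - oo: with u = sqrt e,
exp(-2 u) <= 1 / (1 + 2 u), which lies below 1 - C u^2 as soon as C u <= 1 and
u <= 1/2. *)
Lemma profile_right_slope {R : realType} (c : R) :
  \forall e \near 0^'+, profile e <= c * e.
Proof.
(* C >= - c makes the bound - C e suffice; C >= 2 makes u <= 1/2 a consequence
   of C u <= 1 *)
set C := `|c| + 2.
have C0 : 2 <= C by rewrite lerDr.
near=> e.
have e0 : 0 < e by near: e; exact: nbhs_right_gt.
have eC : e <= (C ^- 2).
  by near: e; apply: nbhs_right_le; rewrite invr_gt0 exprn_gt0//; lra.
have ec : - (C * e) <= c * e.
  by rewrite -mulNr ler_pM2r//; have := ler_norm (- c); rewrite normrN /C; lra.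
rewrite (le_trans _ ec)// /profile (ltW e0) lerBlDr.
set u := Num.sqrt e.
have u0 : 0 < u by rewrite sqrtr_gt0.
have eu : e = u ^+ 2 by rewrite sqr_sqrtr// ltW.
have uC : C * u <= 1.
  rewrite -(@ler_pXn2r _ 2) ?nnegrE//; last by rewrite mulr_ge0 ?ltW//; lra.
  by rewrite exprMn -eu expr1n mulrC -ler_pdivlMr ?div1r// exprn_gt0//; lra.
have uh : u <= 2^-1 by nra.
have cu : 0 <= u * (1 - C * u) by rewrite mulr_ge0 ?subr_ge0// ltW.
have cu2 : 0 <= u * (u * (1 - C * u)) by rewrite mulr_ge0// ltW.
have q : 1 <= (1 + 2 * u) * (1 - C * e) by rewrite eu; nra.
rewrite mulNr expRN -div1r ler_pdivrMr ?expR_gt0//.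
have k0 : 0 <= 1 - C * e by rewrite eu; nra.
apply: (le_trans q); rewrite (addrC _ 1) (mulrC _ (expR _)).
by rewrite ler_wpM2r ?expR_ge1Dx.
Unshelve. all: by end_near. Qed.

(** Lower semicontinuity of the profile. Everywhere it lies above the continuous
function exp(-2 sqrt y) - 1, where sqrt y = 0 for y < 0, and it agrees with this
function at every s >= 0. For s < 0 it is locally constant. *)
Lemma profile_near_gt {R : realType} {s a : R} :
  a < profile s -> \forall y \near s, a < profile y.
Proof.
move=> as_; have [s0|s0] := leP 0 s; last first.
  near=> y; rewrite /profile leNgt ifF.
    by move: as_; rewrite /profile leNgt s0.
  by apply/negbTE/negPn; near: y; exact: lt_nbhsl.
pose G := fun y : R => expR (- 2 * Num.sqrt y) - 1.
have cG : {for s, continuous G}.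
  apply: cvgB; last exact: cvg_cst.
  apply: (@continuous_comp _ _ _ (fun y => - 2 * Num.sqrt y) expR).
    by apply: cvgM; [exact: cvg_cst|exact: sqrt_continuous].
  exact: continuous_expR.
have aG : a < G s by move: as_; rewrite /profile s0.
near=> y.
have aGy : a < G y by near: y; exact: (cvgr_gt _ cG).
rewrite (lt_le_trans aGy)// /profile; case: (leP 0 y) => // y0.
by rewrite /G/= (ltr0_sqrtr y0) mulr0 expR0; lra.
Unshelve. all: by end_near. Qed.

Lemma profile_norm_le1 {R : realType} (s : R) : `|profile s| <= 1.
Proof.
rewrite /profile; case: ifP => _; last by rewrite normr1.
have h0 := expR_gt0 (- 2 * Num.sqrt s).
have h1 : expR (- 2 * Num.sqrt s) <= 1.
  by rewrite -expR0 ler_expR mulNr oppr_le0 mulr_ge0 ?sqrtr_ge0.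
by rewrite ler_norml; apply/andP; split; lra.
Qed.

(** * Subgradients of a travelling wave *)

Lemma pair_vec_neq0 {R : realType} {a b : R} :
  (a != 0) || (b != 0) -> pair_vec a b != 0.
Proof.
apply: contraTN => /eqP/rowP E; rewrite negb_or !negbK.
by have := E 0; have := E 1; rewrite !mxE /= => -> ->; rewrite eqxx.
Qed.

(** Along the ray of direction (a, b), the phase x - t moves at speed b - a. The
ray has to stay in the strip, since the extended function is + oo outside. *)
Lemma travelling_subgradient_le {R : realType} {T : R} {U : R -> R -> R}
    {h : R -> R} {t x p_t p_x a b c : R} :
  (forall t x, 0 <= t <= T -> U t x = h (x - t)) -> 0 <= t <= T ->
  subgradients (extend T (fun t x => (U t x)%:E)) (pair_vec t x)
    (pair_vec p_t p_x) ->
  (a != 0) || (b != 0) ->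
  (\forall e \near 0^'+, 0 <= t + e * a <= T) ->
  (\forall e \near 0^'+, h (x - t + (b - a) * e) <= h (x - t) + c * e) ->
  p_t * a + p_x * b <= c.
Proof.
move=> hU tT sub ab adm slope.
have := subgradient_slope_le (d := pair_vec a b) (c := c) (r := h (x - t)) sub.
have -> : dotprod (pair_vec p_t p_x) (pair_vec a b) = p_t * a + p_x * b.
  by rewrite /dotprod !big_ord_recl big_ord0 !mxE /= addr0.
apply; first exact: pair_vec_neq0.
  by rewrite /extend !mxE /= tT hU.
near=> e; rewrite /extend !mxE /=.
have te : 0 <= t + e * a <= T by near: e.
rewrite te hU// lee_fin.
have -> : x + e * b - (t + e * a) = x - t + (b - a) * e by ring.
by near: e.
Unshelve. all: by end_near. Qed.

(** In the interior, a subgradient is the gradient (- D, D). On each of the two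
boundary lines one of the time rays leaves the strip, and only one inequality on
[p_t] survives: the one that is needed there. *)
Lemma travelling_subgradient_smooth {R : realType} {T : R} {U : R -> R -> R}
    {h : R -> R} {t x p_t p_x D : R} :
  (forall t x, 0 <= t <= T -> U t x = h (x - t)) -> 0 <= t <= T ->
  subgradients (extend T (fun t x => (U t x)%:E)) (pair_vec t x)
    (pair_vec p_t p_x) ->
  is_derive (x - t) 1 h D ->
  [/\ p_x = D, t < T -> p_t <= - D & 0 < t -> - D <= p_t].
Proof.
move=> hU tT sub dh.
have dir a b : (a != 0) || (b != 0) ->
    (\forall e \near 0^'+, 0 <= t + e * a <= T) ->
    p_t * a + p_x * b <= (b - a) * D.
  move=> ab adm; apply/ler_addgt0Pr => eps eps0.
  apply: (travelling_subgradient_le hU tT sub ab adm).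
  by apply: right_slope_le dh _; rewrite ltrDl.
have /andP[t0 tT'] := tT.
split.
- have : p_t * 0 + p_x * 1 <= (1 - 0) * D.
    by apply: dir; [rewrite oner_neq0 orbT|near=> e; rewrite mulr0 addr0].
  have : p_t * 0 + p_x * -1 <= (-1 - 0) * D.
    apply: dir; first by rewrite oppr_eq0 oner_neq0 orbT.
    by near=> e; rewrite mulr0 addr0.
  by move=> *; lra.
- move=> ltT; have : p_t * 1 + p_x * 0 <= (0 - 1) * D.
    apply: dir; first by rewrite oner_neq0.
    near=> e; have e0 : 0 < e by near: e; exact: nbhs_right_gt.
    have eT : e <= T - t by near: e; apply: nbhs_right_le; lra.
    by apply/andP; split; lra.
  by lra.
- move=> lt0; have : p_t * -1 + p_x * 0 <= (0 - -1) * D.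
    apply: dir; first by rewrite oppr_eq0 oner_neq0.
    near=> e; have e0 : 0 < e by near: e; exact: nbhs_right_gt.
    have eT : e <= t by near: e; apply: nbhs_right_le; lra.
    by apply/andP; split; lra.
  by lra.
Unshelve. all: by end_near. Qed.

Lemma profile_no_subgradient_diag {R : realType} {T : R} {U : R -> R -> R}
    {t p_t p_x : R} :
  (forall t x, 0 <= t <= T -> U t x = profile (x - t)) -> 0 <= t <= T ->
  ~ subgradients (extend T (fun t x => (U t x)%:E)) (pair_vec t t)
      (pair_vec p_t p_x).
Proof.
move=> hU tT sub.
suff : p_t * 0 + p_x * 1 <= p_x - 1 by lra.
apply: (travelling_subgradient_le hU tT sub).
- by rewrite oner_neq0 orbT.
- by near=> e; rewrite mulr0 addr0.
- near=> e; rewrite subrr add0r subr0 mul1r.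
  (* the value at the wave front is profile 0 = 0 *)
  rewrite {2}/profile lexx sqrtr0 mulr0 expR0 subrr add0r.
  by near: e; exact: profile_right_slope.
Unshelve. all: by end_near. Qed.

(** * Values of the Hamiltonian *)

Lemma hamiltonian_inv_phi {R : realType} {t x : R} : t != x ->
  hamiltonian t x (phi t x)^-1 = (phi t x)^-1.
Proof.
move=> tx; have ph : 0 < (phi t x)^-1.
  by rewrite invr_gt0 mulr_gt0 ?expR_gt0// sqrtr_gt0 normr_gt0 subr_eq0.
by rewrite /hamiltonian (negbTE tx) div1r gtr0_norm// ifF; lra.
Qed.

Lemma hamiltonian0 {R : realType} (t x : R) : hamiltonian t x 0 = 0.
Proof.
rewrite /hamiltonian; case: ifP => // _; rewrite normr0 mulr0 ifT//.
by rewrite div1r invr_ge0 mulr_ge0 ?expR_ge0// sqrtr_ge0.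
Qed.

Theorem theorem4p2 (R : realType) (T : R) (U : R -> R -> R)
    (hT : 0 < T)
    (hU : forall t x, 0 <= t <= T ->
      U t x = if t <= x then expR (- 2 * Num.sqrt (x - t)) - 1 else 1) :
  [bounded U z.1 z.2 | z in strip T] /\
  lsc_solution T (@hamiltonian R) (terminal_cost T) (fun t x => (U t x)%:E).
Proof.
have {}hU t x : 0 <= t <= T -> U t x = profile (x - t).
  by move=> tT; rewrite hU// profileE.
split.
  exists 1; split; first by rewrite num_real.
  move=> M M1 z zT; rewrite /= hU//.
  by rewrite (le_trans (profile_norm_le1 _))// ltW.
split => [//|z a|x|t x tT _ p_t p_x sub].
- rewrite lte_fin => az; exists [set y | a < U y.1 y.2]; last first.
    by move=> y /=; rewrite lte_fin.
  (* at a point outside the strip the neighbourhood filter is principal *)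
  rewrite /nbhs/= /nbhs_subspace; case: ifPn => [|_]; last by move=> y /= ->.
  rewrite inE => zT; rewrite hU// in az.
  have near_z : \forall y \near (z : R * R), a < profile (y.2 - y.1).
    have c : (y.2 - y.1) @[y --> (z : R * R)] --> (z.2 - z.1 : R).
      by apply: cvgB; [exact: cvg_snd|exact: cvg_fst].
    exact: c (profile_near_gt az).
  apply: (@filterS _ (nbhs (z : R * R)) _ _ _ _ near_z) => y /= ay yT.
  by rewrite hU.
- by rewrite hU ?lexx ?ltW// -profileE.
- have [tx|xt|tx] := ltgtP t x.
  + have s0 : 0 < x - t by rewrite subr_gt0.
    have phiE : expR (- 2 * Num.sqrt (x - t)) / Num.sqrt (x - t) = (phi t x)^-1.
      by rewrite /phi distrC gtr0_norm// invfM mulNr expRN mulrC.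
    have := is_derive_profile_pos s0; rewrite phiE => dh.
    have [-> pt_le pt_ge] := travelling_subgradient_smooth hU tT sub dh.
    rewrite opprK hamiltonian_inv_phi ?lt_eqF//.
    split=> /andP[h1 h2]; [have := pt_le h2|have := pt_ge h1]; lra.
  + have s0 : x - t < 0 by rewrite subr_lt0.
    have dh := is_derive_profile_neg s0.
    have [-> pt_le pt_ge] := travelling_subgradient_smooth hU tT sub dh.
    rewrite oppr0 hamiltonian0.
    split=> /andP[h1 h2]; [have := pt_le h2|have := pt_ge h1]; lra.
  + by move: sub; rewrite -tx => /(profile_no_subgradient_diag hU tT).
Qed.
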